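(* Let $n$ be a positive integer and $\mathbf b=(b_1,\dots,b_n)\in\mathbb Z_{>0}^n$, not with $n=1=b_1$. If $b_1=1$, the circuit diameter of $\mathfrak X_n(\mathbf b)$ is at most $n-1$. If $b_1\ge2$, the circuit diameter of $\mathfrak X_n(\mathbf b)$ is at most $n$. Moreover, these bounds are tight when circuit walks are restricted to use only the circuit directions $\pm\mathbf e_i$ $(1\le i\le n)$ and $\mathbf e_i-\mathbf e_j$ $(1\le i,j\le n,\ i\ne j)$; that is, the maximum over ordered pairs of vertices $(\mathbf u,\mathbf w)$ of the minimum length of a circuit walk from $\mathbf u$ to $\mathbf w$ using only these directions equals $n-1$ if $b_1=1$ and $n$ if $b_1\ge2$.
   Context: A $\mathbf b$-parking function is a list $(\beta_1,\dots,\beta_n)$ of positive integers whose nondecreasing rearrangement $\beta'_1\le\cdots\le\beta'_n$ satisfies $\beta'_i\le b_1+\cdots+b_i$ for all $i$. The $\mathbf b$-parking-function polytope $\mathfrak X_n(\mathbf b)\subset\mathbb R^n$ is the convex hull of all $\mathbf b$-parking functions. For a full-dimensional polytope $P=\{x\in\mathbb R^n:Ax\le d\}$ given by its minimal inequality description, a circuit (elementary vector) of $P$ is a nonzero vector $g\in\mathbb R^n$ such that $Ag$ has inclusion-minimal support among $\{Ay:y\in\mathbb R^n,\ y\ne0\}$; circuits are considered up to positive scaling. For $\mathfrak X_n(\mathbf b)$ the minimal description consists of $x_i\ge1$ for $1\le i\le n$ and $\sum_{i\in I}x_i\le\sum_{i=n-|I|+1}^n(b_1+\cdots+b_i)$ for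 all nonempty $I\subseteq\{1,\dots,n\}$ (only those with $|I|\ne n-1$ if $b_1=1$); the vectors $\pm\mathbf e_i$ and $\mathbf e_i-\mathbf e_j$ $(i\ne j)$ are among its circuits. A circuit walk of length $t$ from a vertex $\mathbf u$ to a vertex $\mathbf w$ of $P$ is a sequence $\mathbf u=x^0,x^1,\dots,x^t=\mathbf w$ of points of $P$ such that for each $s$ there are a circuit $g$ and $\lambda>0$ with $x^{s+1}=x^s+\lambda g$ and $x^s+\lambda'g\notin P$ for all $\lambda'>\lambda$ (maximal steps; intermediate points need not be vertices). The circuit diameter of $P$ is the maximum over ordered pairs of vertices of the length of a shortest circuit walk from one to the other. *)

(* Defs.v *)
From mathcomp Require Import all_boot all_order all_algebra.
From mathcomp Require Import boolp classical_sets reals convex.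

Set Implicit Arguments.
Unset Strict Implicit.
Unset Printing Implicit Defensive.

Import Order.TTheory GRing.Theory Num.Theory.
Local Open Scope classical_set_scope.
Local Open Scope ring_scope.

Section Parking.
Variables (R : realType) (n : nat).

(* Indices start at 0: [b i] is b_(i+1), so this is b_1 + ... + b_(i+1). *)
Definition partial_sum (b : 'I_n -> nat) (i : 'I_n) : nat :=
  (\sum_(j < n | j <= i) b j)%N.

Definition parking_function (b : 'I_n -> nat) (beta : n.-tuple nat) : Prop :=
  (forall i, (0 < tnth beta i)%N) /\
  (forall i, (tnth (sort_tuple leq beta) i <= partial_sum b i)%N).

Definition convex_hull (S : set 'cV[R]_n) : set 'cV[R]_n :=
  smallest (@convex_set R 'cV[R]_n) S.

Definition parking_polytope (b : 'I_n -> nat) : set 'cV[R]_n :=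
  convex_hull [set x | exists2 beta, parking_function b beta &
                         x = \col_i (tnth beta i)%:R].

End Parking.

Arguments parking_polytope R {n} b _.

Section Circuits.
Variables (R : realType) (n : nat).
Implicit Types (P D : set 'cV[R]_n) (u w x g : 'cV[R]_n).

(* A vertex is a 0-dimensional face, that is, the unique point of [P] where
   some linear functional attains its maximum over [P]. *)
Definition vertex P u : Prop :=
  P u /\ exists c : 'rV[R]_n,
    forall x, P x -> x <> u -> (c *m x) 0 0 < (c *m u) 0 0.

Definition solutions m (A : 'M[R]_(m, n)) (d : 'cV[R]_m) : set 'cV[R]_n :=
  [set x | forall i, (A *m x) i 0 <= d i 0].

Definition minimal_description P m (A : 'M[R]_(m, n)) (d : 'cV[R]_m) : Prop :=
  P = solutions A d /\ forall i, solutions (row' i A) (row' i d) <> P.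

Definition supp m (v : 'cV[R]_m) : {set 'I_m} := [set i | v i 0 != 0]%SET.

(* The minimal description of a full-dimensional polytope is unique up to the
   order of the rows and positive rescaling of each of them; neither affects
   which supports are minimal, so the choice of [A] and [d] is immaterial. *)
Definition circuit P g : Prop :=
  g != 0 /\
  exists m (A : 'M[R]_(m, n)) (d : 'cV[R]_m),
    minimal_description P A d /\
    forall y : 'cV[R]_n, y != 0 -> ~~ (supp (A *m y) \proper supp (A *m g)).

Definition maximal_step P g x x' : Prop :=
  exists2 lambda : R, 0 < lambda &
    x' = x + lambda *: g /\
    forall lambda', lambda < lambda' -> ~ P (x + lambda' *: g).

(* Walks of length [t] with directions in [D]; only x 0, ..., x t matter. *)
Definition walk P D (t : nat) u w : Prop :=
  exists x : nat -> 'cV[R]_n,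
    [/\ x 0%N = u, x t = w,
        forall s, (s <= t)%N -> P (x s) &
        forall s, (s < t)%N -> exists2 g, D g & maximal_step P g (x s) (x s.+1)].

Definition walk_distance P D u w (t : nat) : Prop :=
  walk P D t u w /\ forall s, walk P D s u w -> (t <= s)%N.

Definition walk_diameter P D (k : nat) : Prop :=
  (forall u w, vertex P u -> vertex P w ->
     exists2 t, walk_distance P D u w t & (t <= k)%N) /\
  (exists u w, [/\ vertex P u, vertex P w & walk_distance P D u w k]).

Definition circuit_diameter P (k : nat) : Prop := walk_diameter P (circuit P) k.

Definition basis_vec (i : 'I_n) : 'cV[R]_n := delta_mx i 0.

Definition root_direction g : Prop :=
  (exists i, g = basis_vec i \/ g = - basis_vec i) \/
  (exists i j, i <> j /\ g = basis_vec i - basis_vec j).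

Definition root_circuit_diameter P (k : nat) : Prop :=
  walk_diameter P (circuit P `&` root_direction) k.

End Circuits.

(* Main.v *)
(* Shifting to [x - 1] turns the polytope into a polymatroid with a strictly
   concave rank function. The tight sets of a point are tails of its sorted
   coordinates, so the vertices are the greedy points: the largest n - m
   coordinates are the partial sums B_n > B_(n-1) > ... > B_(m+1), in any
   positions, and the remaining m are 1.

   Upper bound: settle the coordinates of the target in decreasing order. If the
   required value sits elsewhere, one maximal step along [e_i - e_j] exchanges
   the two values; if all remaining coordinates are 1, one step along [e_i]
   raises the coordinate to the required value; the surplus coordinates are
   finally lowered to 1 along [- e_i]. Each coordinate costs at most one step,
   and the last one is free if b_1 = 1.

   Lower bound: the directions of a walk are edges of a graph on the n
   coordinates and one extra node. With t < n steps at least n - t components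
   avoid the extra node and the coordinate sum over each of them is invariant.
   Going from (1, ..., 1) to (B_1, ..., B_n), every coordinate with B_i > 1
   increases strictly, so such a component lies among those with B_i = 1. *)

Require Import Defs.
From mathcomp Require Import all_boot all_order all_algebra all_fingroup.
From mathcomp Require Import boolp classical_sets reals convex.
From mathcomp Require Import interval_inference.
From mathcomp Require Import ring lra zify.

Set Implicit Arguments.
Unset Strict Implicit.
Unset Printing Implicit Defensive.

Import Order.TTheory GRing.Theory Num.Theory.

(** * Polyhedra and their basic points *)

Section Polyhedra.
Local Open Scope classical_set_scope.
Local Open Scope ring_scope.
Variables (R : realType) (n : nat).
Implicit Types (x y g : 'cV[R]_n) (C : set 'cV[R]_n).

Lemma convex_setP C :
  @convex_set R 'cV[R]_n C <->
  forall x y (l : R), 0 <= l -> l <= 1 -> C x -> C y ->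
    C (l *: x + (1 - l) *: y).
Proof.
split=> [cC x y l l0 l1 Cx Cy | cC x y l].
  have := cC x y (Itv01 l0 l1).
  by rewrite !inE => /(_ Cx Cy).
by rewrite !inE => Cx Cy; apply: cC.
Qed.

Variables (T : finType) (a : T -> 'rV[R]_n) (d : T -> R).

Definition polyhedron : set 'cV[R]_n :=
  [set x | forall t, (a t *m x) 0 0 <= d t].

Definition tight x t := (a t *m x) 0 0 == d t.

(** The tight rows have trivial common kernel, hence rank [n]: the algebraic form of an extreme
    point. *)
Definition basic_point x :=
  forall g, (forall t, tight x t -> (a t *m g) 0 0 = 0) -> g = 0.

Lemma mulmx_line (r : 'rV[R]_n) x (l : R) g :
  (r *m (x + l *: g)) 0 0 = (r *m x) 0 0 + l * (r *m g) 0 0.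
Proof. by rewrite mulmxDr -scalemxAr !mxE. Qed.

Lemma polyhedron_convex : @convex_set R 'cV[R]_n polyhedron.
Proof.
apply/convex_setP => x y l l0 l1 Px Py t.
rewrite mulmxDr -!scalemxAr !mxE.
have := Px t; have := Py t; rewrite !mxE; nra.
Qed.

(** The ratio test: the row with the least quotient of slack by speed along [g] blocks first, while
    the rows tight at [x] are constant along [g] and stay tight. *)
Lemma polyhedron_exit x g t0 :
  polyhedron x -> (forall t, tight x t -> (a t *m g) 0 0 = 0) ->
  0 < (a t0 *m g) 0 0 ->
  exists l : R, [/\ 0 < l, polyhedron (x + l *: g) &
    [set t | tight x t]%SET \proper [set t | tight (x + l *: g) t]%SET].
Proof.
move=> Px tg gt0.
pose q t := (d t - (a t *m x) 0 0) / (a t *m g) 0 0.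
case: (@Order.TotalTheory.arg_minP _ _ _ t0 (fun t => 0 < (a t *m g) 0 0) q gt0).
move=> i gi qmin.
have slack t : 0 < (a t *m g) 0 0 -> (a t *m x) 0 0 < d t.
  move=> gt; rewrite lt_neqAle Px andbT; apply/negP => /tg e.
  by rewrite e ltxx in gt.
have q_gt0 : 0 < q i by rewrite divr_gt0 // subr_gt0 slack.
exists (q i); split => //.
  move=> t; rewrite mulmx_line.
  have [gt|gt] := ltP 0 ((a t *m g) 0 0).
    have := qmin t gt; rewrite {2}/q ler_pdivlMr //; lra.
  have := Px t; nra.
apply/properP; split.
  apply/fintype.subsetP => t; rewrite !inE => tx.
  by rewrite /tight mulmx_line (tg _ tx) mulr0 addr0.
exists i; rewrite !inE /tight; last by rewrite lt_eqF // slack.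
have gi0 : (a i *m g) 0 0 != 0 by rewrite gt_eqF.
by rewrite mulmx_line /q divfK // addrC subrK.
Qed.

(** Induction on the number of slack rows. A point that is not basic can move both ways along some
    [g] killed by its tight rows; by boundedness both rays stop where more rows are tight, and the
    point lies between the two ends. *)
Lemma basic_points_generate C :
  (forall g, g != 0 -> exists t, 0 < (a t *m g) 0 0) ->
  @convex_set R 'cV[R]_n C ->
  (forall x, polyhedron x -> basic_point x -> C x) ->
  polyhedron `<=` C.
Proof.
move=> bounded /convex_setP cC bC x.
have [k] := ubnP #|[set t | ~~ tight x t]%SET|.
elim: k x => // k IH x lek Px.
have IH' l g : polyhedron (x + l *: g) ->
    [set t | tight x t]%SET \proper [set t | tight (x + l *: g) t]%SET ->
    C (x + l *: g).
  move=> Pl /properP [/fintype.subsetP s1 [t t1 t2]].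
  apply: IH => //; rewrite -ltnS; apply: leq_trans lek; rewrite ltnS.
  apply: proper_card; apply/properP; split; last first.
    by exists t; rewrite !inE in t1 t2 *; rewrite ?t1.
  by apply/fintype.subsetP => u; rewrite !inE; apply: contra => tu; have := s1 u; rewrite !inE => ->.
have [bx|] := pselect (basic_point x); first exact: bC.
move=> /existsNP [g] /not_implyP [tg /eqP g0].
have [t1 gt1] := bounded _ g0.
have [|t2 gt2] := bounded (- g); first by rewrite oppr_eq0.
have tNg t : tight x t -> (a t *m (- g)) 0 0 = 0.
  by move=> /tg e; rewrite mulmxN mxE e oppr0.
have [l1 [l1_gt0 P1 T1]] := polyhedron_exit Px tg gt1.
have [l2 [l2_gt0 P2 T2]] := polyhedron_exit Px tNg gt2.
have l12 : l1 + l2 != 0 by rewrite gt_eqF // addr_gt0.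
have -> : x = (l2 / (l1 + l2)) *: (x + l1 *: g)
            + (1 - l2 / (l1 + l2)) *: (x + l2 *: - g).
  by apply/colP => i; rewrite !mxE; field.
apply: cC; [| |exact: IH'|exact: IH'].
  by rewrite divr_ge0 // ?addr_ge0 // ltW.
by rewrite ler_pdivrMr ?addr_gt0 //; lra.
Qed.

(** If all tight rows kill a nonzero [g], short steps along [g] and [- g] stay inside, and no linear
    functional decreases along both. *)
Lemma vertex_basic_point x : vertex polyhedron x -> basic_point x.
Proof.
case=> Px [c cmax] g tg; apply/eqP/negPn/negP => g0.
(* A common step length along [g] and [-g] that keeps all slacks nonnegative. *)
have [e [e_gt0 eP]] : exists e : R, 0 < e /\
    forall t, e * `|(a t *m g) 0 0| <= d t - (a t *m x) 0 0.
  (* A tight row kills [g] and imposes nothing, hence the default 1; the [+ 1] keeps the denominator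
     positive where a slack row kills [g]. *)
  pose r t := if tight x t then 1
              else (d t - (a t *m x) 0 0) / (`|(a t *m g) 0 0| + 1).
  have r_gt0 t : 0 < r t.
    rewrite /r; case: ifP => // /negbT nt; apply: divr_gt0.
      by rewrite subr_gt0 lt_neqAle nt Px.
    by have := normr_ge0 ((a t *m g) 0 0); lra.
  exists (\big[Order.min/1]_t r t); split.
    by elim/big_ind: _ => // u v u0 v0; rewrite lt_min u0.
  move=> t; case tt : (tight x t).
    by rewrite (tg _ tt) normr0 mulr0 subr_ge0 Px.
  have le : \big[Order.min/1]_t r t <= r t.
    by rewrite (bigD1 t) //= ge_min lexx.
  apply: (le_trans (ler_wpM2r (normr_ge0 _) le)).
  rewrite /r tt; set u := `|_|; have u0 : 0 <= u by exact: normr_ge0.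
  have s0 : 0 <= d t - (a t *m x) 0 0 by rewrite subr_ge0 Px.
  rewrite mulrAC ler_pdivrMr; nra.
have P1 : polyhedron (x + e *: g).
  move=> t; rewrite mulmx_line; have := eP t.
  by have := ler_norm ((a t *m g) 0 0); nra.
have P2 : polyhedron (x + (- e) *: g).
  move=> t; rewrite mulmx_line; have := eP t.
  by have := ler_norm (- ((a t *m g) 0 0)); rewrite normrN; nra.
have ne (s : R) : s != 0 -> x + s *: g <> x.
  by move=> s0 /eqP; rewrite -subr_eq0 addrC addKr scaler_eq0 (negPf s0) (negPf g0).
have e0 : e != 0 by rewrite gt_eqF.
have Ne0 : - e != 0 by rewrite oppr_eq0.
have := cmax _ P1 (ne _ e0); have := cmax _ P2 (ne _ Ne0).
rewrite !mulmx_line; lra.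
Qed.

End Polyhedra.

(** * Tail sums *)

Section TailSums.
Local Open Scope ring_scope.
Variables (R : realType) (n : nat).
Implicit Types (y : 'I_n -> R) (J : {set 'I_n}).

Definition tail_sum y (k : nat) : R := \sum_(i < n | (k <= i)%N) y i.

Lemma tail_sum_recl y (i : 'I_n) : tail_sum y i = y i + tail_sum y i.+1.
Proof.
rewrite /tail_sum (bigD1 i) //=; congr (_ + _); apply: eq_bigl => j.
by rewrite ltn_neqAle andbC eq_sym.
Qed.

Lemma tail_sum_geq y k : (n <= k)%N -> tail_sum y k = 0.
Proof.
move=> nk; rewrite /tail_sum big1 // => i ki.
by have := leq_trans nk ki; rewrite leqNgt ltn_ord.
Qed.

Lemma card_tail k : (\sum_(i < n | k <= i) 1 = n - k)%N.
Proof.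
have := @big_geq_mkord _ 0%N addn k n (fun=> true) (fun=> 1%N).
by rewrite /= => <-; rewrite sum_nat_const_nat muln1.
Qed.

Lemma tail_sum1 k : tail_sum (fun=> 1) k = (n - k)%:R.
Proof. by rewrite -card_tail natr_sum. Qed.

Lemma ler_tail_sum y y' k : (forall i : 'I_n, (k <= i)%N -> y i <= y' i) ->
  tail_sum y k <= tail_sum y' k.
Proof. by move=> le; apply: ler_sum => i; apply: le. Qed.

(* Both index sets have [n - k] elements, so [y] may be shifted by [theta];
   the comparison then holds term by term. *)
Lemma tail_sum_sub y (theta : R) k J : #|J| = (n - k)%N ->
  tail_sum y k - \sum_(i in J) y i =
  \sum_(i < n) ((k <= i)%N%:R - (i \in J)%:R) * (y i - theta).
Proof.
move=> cJ.
have boolsum (f : 'I_n -> R) : tail_sum f k - \sum_(i in J) f i =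
    \sum_(i < n) ((k <= i)%N%:R - (i \in J)%:R) * f i.
  rewrite /tail_sum big_mkcond [X in _ - X]big_mkcond -sumrB.
  apply: eq_bigr => i _.
  by case: (k <= i)%N; case: (i \in J); rewrite /=; ring.
have /esym e := boolsum (fun=> 1).
rewrite tail_sum1 sumr_const cJ subrr in e.
transitivity (\sum_(i < n) ((k <= i)%N%:R - (i \in J)%:R) * y i
  - (\sum_(i < n) ((k <= i)%N%:R - (i \in J)%:R) * 1) * theta).
  by rewrite e mul0r subr0 boolsum.
rewrite mulr_suml -sumrB.
by apply: eq_bigr => i _; ring.
Qed.

(** With [theta] equal to [y] at index [k], both factors of each term of the difference have the
    same sign. *)
Lemma sum_le_tail_sum y k J :
  (forall i j : 'I_n, (i <= j)%N -> y i <= y j) -> #|J| = (n - k)%N ->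
  \sum_(i in J) y i <= tail_sum y k.
Proof.
move=> ymono cJ; have [nk|kn] := leqP n k.
  have /cards0_eq -> : #|J| = 0%N by apply/eqP; rewrite cJ subn_eq0.
  by rewrite tail_sum_geq // big_set0.
rewrite -subr_ge0 (tail_sum_sub _ (y (Ordinal kn)) cJ) sumr_ge0 // => i _.
have [ki|ik] := leqP k i.
  by rewrite mulr_ge0 // subr_ge0; [case: (_ \in _)|apply: ymono].
rewrite mulr_le0 // subr_le0; first by case: (_ \in _).
by apply: ymono; exact: ltnW.
Qed.

(** As [theta] strictly separates the tail from the rest, each term of the difference is nonnegative
    and vanishes only where the two indicators agree. *)
Lemma tail_sum_unique y (theta : R) k J :
  (forall i : 'I_n, (k <= i)%N -> theta < y i) ->
  (forall i : 'I_n, (i < k)%N -> y i < theta) ->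
  #|J| = (n - k)%N -> tail_sum y k <= \sum_(i in J) y i ->
  forall i, (i \in J) = (k <= i)%N.
Proof.
move=> yge ylt cJ; rewrite -subr_le0 (tail_sum_sub _ theta cJ) => le0.
have ge0 i : i \in 'I_n -> 0 <= ((k <= i)%N%:R - (i \in J)%:R) * (y i - theta).
  move=> _; have [ki|ik] := leqP k i.
    by rewrite mulr_ge0 ?subr_ge0 ?(ltW (yge _ _)) //; case: (_ \in _).
  by rewrite mulr_le0 ?subr_le0 ?(ltW (ylt _ _)) //; case: (_ \in _).
have sum0 := le_anti (introT andP (conj le0 (sumr_ge0 _ ge0))).
move=> i; have /eqP := psumr_eq0P ge0 sum0 (isT : i \in 'I_n).
rewrite mulf_eq0 !subr_eq0 => /orP [|/eqP e].
  by rewrite eqr_nat; case: (_ \in _); case: (_ <= _)%N.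
by have [/yge|/ylt] := leqP k i; rewrite e ltxx.
Qed.

Lemma sorting_perm y :
  exists s : 'S_n, forall i j : 'I_n, (i <= j)%N -> y (s i) <= y (s j).
Proof.
pose t := [tuple y i | i < n].
have tot : total (<=%R : rel R) by exact: le_total.
have pe : perm_eq (sort_tuple <=%R t) t by rewrite perm_sort.
have [s es] := tuple_permP pe.
exists s => i j ij.
have nth_s (k : 'I_n) : nth 0 (sort <=%R t) k = y (s k).
  transitivity (tnth t (s k)); last by rewrite tnth_mktuple.
  have -> : sort <=%R t = [tuple tnth t (s i) | i < n] by [].
  by rewrite -tnth_nth tnth_mktuple.
rewrite -!nth_s; apply: sorted_leq_nth => //; first exact: le_trans.
- exact: sort_sorted.
- by rewrite inE size_sort size_tuple.
- by rewrite inE size_sort size_tuple.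
Qed.

End TailSums.

(** * Greedy points *)

Section BoxedPermutohedron.
Local Open Scope classical_set_scope.
Local Open Scope ring_scope.
Variables (R : realType) (n : nat) (B : 'I_n -> R).
Hypotheses (B_ge1 : forall i, 1 <= B i)
  (B_incr : forall i j : 'I_n, (i < j)%N -> B i + 1 <= B j).
Implicit Types (x g : 'cV[R]_n) (s : 'S_n) (I : {set 'I_n}).

(** All inequalities are listed here, including redundant ones such as that of the empty set;
    [irredundant] selects among them later. *)
Definition facet_row (t : 'I_n + {set 'I_n}) : 'rV[R]_n :=
  match t with
  | inl i => - delta_mx 0 i
  | inr J => \row_j (j \in J)%:R
  end.

Definition facet_bound (t : 'I_n + {set 'I_n}) : R :=
  match t with
  | inl i => -1
  | inr J => tail_sum B (n - #|J|)
  end.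

Definition greedy_polytope : set 'cV[R]_n := polyhedron facet_row facet_bound.

(* The coordinates [s i] with [i < m] are 1, the others the largest values
   allowed by the greedy algorithm. *)
Definition greedy_point s (m : nat) : 'cV[R]_n :=
  \col_j (if ((s^-1)%g j < m)%N then 1 else B ((s^-1)%g j)).

Lemma greedy_pointE s m i :
  greedy_point s m (s i) 0 = if (i < m)%N then 1 else B i.
Proof. by rewrite mxE permK. Qed.

Lemma facet_rowl i x : (facet_row (inl i) *m x) 0 0 = - x i 0.
Proof.
rewrite mxE (bigD1 i) //= big1 ?addr0 => [|j ji]; rewrite !mxE.
  by rewrite !eqxx mulN1r.
by rewrite (negPf ji) andbF oppr0 mul0r.
Qed.

Lemma facet_rowr I x : (facet_row (inr I) *m x) 0 0 = \sum_(i in I) x i 0.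
Proof.
rewrite mxE [RHS]big_mkcond; apply: eq_bigr => i _.
by rewrite mxE; case: (i \in I); rewrite ?mul1r ?mul0r.
Qed.

Lemma greedy_polytopeP x : greedy_polytope x <->
  (forall i, 1 <= x i 0) /\
  (forall I, \sum_(i in I) x i 0 <= tail_sum B (n - #|I|)).
Proof.
split=> [Qx|[x1 xI] [i|J]].
- split=> [i|J]; first by have := Qx (inl i); rewrite facet_rowl lerN2.
  by have := Qx (inr J); rewrite facet_rowr.
- by rewrite facet_rowl lerN2; apply: x1.
- by rewrite facet_rowr; apply: xI.
Qed.

Lemma B_mono (i j : 'I_n) : (i <= j)%N -> B i <= B j.
Proof.
rewrite leq_eqVlt => /orP [/eqP /val_inj -> //|/B_incr]; lra.
Qed.

Lemma card_perm_preim s I : #|[set i | s i \in I]%SET| = #|I|.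
Proof.
rewrite -!sum1_card [RHS](reindex_inj (@perm_inj _ s)) /=.
by apply: eq_bigl => i; rewrite inE.
Qed.

Lemma sum_perm_preim s I (f : 'I_n -> R) :
  \sum_(i in I) f i = \sum_(i in [set i | s i \in I]%SET) f (s i).
Proof.
rewrite (reindex_inj (@perm_inj _ s)) /=.
by apply: eq_bigl => i; rewrite inE.
Qed.

Lemma greedy_polytope_dominated s x : (forall i, 1 <= x i 0) ->
  (forall i, x (s i) 0 <= B i) -> greedy_polytope x.
Proof.
move=> x1 xB; apply/greedy_polytopeP; split=> // I.
rewrite (sum_perm_preim s); apply: (@le_trans _ _ (\sum_(i in [set i | s i \in I]%SET) B i)).
  exact: ler_sum.
apply: sum_le_tail_sum; first exact: B_mono.
by rewrite card_perm_preim subKn // -[n in (_ <= n)%N]card_ord max_card.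
Qed.

Lemma greedy_point_in_polytope s m : greedy_polytope (greedy_point s m).
Proof.
apply: (@greedy_polytope_dominated s) => i; last by rewrite greedy_pointE; case: ifP.
by rewrite mxE; case: ifP.
Qed.

Lemma card_tail_set s k : (k <= n)%N ->
  #|[set j | (k <= (s^-1)%g j)%N]%SET| = (n - k)%N.
Proof.
move=> kn; rewrite -(card_perm_preim s) -card_tail -sum1_card.
by apply: eq_bigl => i; rewrite !inE permK.
Qed.

Lemma tail_sum_perm s x k :
  tail_sum (fun i => x (s i) 0) k =
  \sum_(j in [set j | (k <= (s^-1)%g j)%N]%SET) x j 0.
Proof.
rewrite (sum_perm_preim s) /tail_sum; apply: eq_bigl => i.
by rewrite !inE permK.
Qed.

Lemma tail_sum_le s x k : greedy_polytope x -> (k <= n)%N ->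
  tail_sum (fun i => x (s i) 0) k <= tail_sum B k.
Proof.
move=> /greedy_polytopeP [_ xI] kn; rewrite tail_sum_perm.
by apply: (le_trans (xI _)); rewrite card_tail_set // subKn.
Qed.

(* [B] increases strictly, so in a sorted point the coordinates jump across
   the end of a tight set, which is therefore a tail. *)
Lemma tight_set_tail s x I :
  greedy_polytope x -> (forall i j : 'I_n, (i <= j)%N -> x (s i) 0 <= x (s j) 0) ->
  \sum_(i in I) x i 0 = tail_sum B (n - #|I|) ->
  tail_sum B (n - #|I|) <= tail_sum (fun i => x (s i) 0) (n - #|I|) /\
  forall i, (s i \in I) = (n - #|I| <= i)%N.
Proof.
move=> Qx mono; set k := (n - #|I|)%N; set y := fun i => x (s i) 0.
pose J := [set i | s i \in I]%SET.
have cI : (#|I| <= n)%N by rewrite -[n in (_ <= n)%N]card_ord max_card.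
have cJ : #|J| = (n - k)%N by rewrite card_perm_preim subKn.
rewrite (sum_perm_preim s) -/J => /eqP; rewrite eq_le => /andP [_ tI].
have tk : tail_sum B k <= tail_sum y k.
  exact: le_trans tI (sum_le_tail_sum mono cJ).
split=> //.
have yJ : tail_sum y k <= \sum_(i in J) y i.
  by apply: le_trans tI; apply: tail_sum_le; rewrite ?leq_subr.
suff [theta ge lt] : exists2 theta, forall i : 'I_n, (k <= i)%N -> theta < y i
    & forall i : 'I_n, (i < k)%N -> y i < theta.
  by move=> i; have := tail_sum_unique ge lt cJ yJ i; rewrite inE.
have [x1 _] := (greedy_polytopeP x).1 Qx.
have kn : (k <= n)%N by rewrite leq_subr.
have ymono (i j : 'I_n) : (i <= j)%N -> y i <= y j := @mono i j.
case ek : k => [|k']; first by exists 0 => // i _; apply: lt_le_trans (x1 _).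
rewrite -ek; have k'n : (k' < n)%N by rewrite -ek.
(* [p] is the last index below the tail and [q], if there is one, the first index in it. Comparing
   tail sums at consecutive indices gives [y p <= B p] and [B q <= y q], so the midpoint of [y p]
   and [y q] separates. *)
pose p := Ordinal k'n.
have yp : y p <= B p.
  have := tail_sum_le s Qx (ltnW k'n).
  have := tail_sum_recl y p; have := tail_sum_recl B p.
  by rewrite /= -ek -/y; lra.
have [nk|kn'] := leqP n k.
  exists (y p + 1) => i; first by move/(leq_trans nk); rewrite leqNgt ltn_ord.
  by rewrite ek ltnS => ip; have := ymono i p ip; lra.
pose q := Ordinal kn'.
have yq : B q <= y q.
  have := tail_sum_le s Qx kn'.
  have := tail_sum_recl y q; have := tail_sum_recl B q.
  by rewrite /= -/y; lra.
have := @B_incr p q; rewrite /= ek ltnSn => /(_ isT) Bpq.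
exists ((y p + y q) / 2) => i.
  by move=> ki; have := ymono q i; rewrite /= ek => /(_ ki); lra.
by rewrite ltnS => ip; have := ymono i p ip; lra.
Qed.

Lemma tail_sum_split (y : 'I_n -> R) k m : (k <= m)%N ->
  tail_sum y k = \sum_(i < n | (k <= i < m)%N) y i + tail_sum y m.
Proof.
move=> km; rewrite /tail_sum (bigID (fun i : 'I_n => (i < m)%N)) /=.
congr (_ + _); apply: eq_bigl => i; rewrite -leqNgt.
by have [mi|] := leqP m i; rewrite ?andbF // andbT (leq_trans km).
Qed.

Lemma sum_basis_vec (I : {set 'I_n}) i :
  \sum_(j in I) (basis_vec R i) j 0 = (i \in I)%:R.
Proof.
have [iI|iI] := boolP (i \in I).
  rewrite (bigD1 i) //= big1 ?addr0 ?mxE ?eqxx // => j /andP [_ ne].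
  by rewrite mxE (negPf ne).
rewrite big1 // => j jI; rewrite mxE andbT.
by case: eqP => // e; rewrite -e jI in iI.
Qed.

(** Sort the coordinates and let [m] be the number of ones. Every nonzero direction changes some
    tight row; suitable directions show that all tail sums from [m] on agree with those of [B], and
    their differences are the coordinates. *)
Lemma basic_point_greedy x : greedy_polytope x -> basic_point facet_row facet_bound x ->
  exists s m, x = greedy_point s m.
Proof.
move=> Qx bx; have [x1 xI] := (greedy_polytopeP x).1 Qx.
have [s mono] := sorting_perm (fun i => x i 0).
pose y i := x (s i) 0.
have moving g : g != 0 -> exists2 t, tight facet_row facet_bound x t
    & (facet_row t *m g) 0 0 != 0.
  move=> /eqP g0; apply: contrapT => nex; apply: g0; apply: bx => t tt.
  by apply/eqP/negPn/negP => nz; apply: nex; exists t.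
pose P k := [forall i : 'I_n, (k <= i)%N ==> (1 < y i)].
have exP : exists k, P k.
  by exists n; apply/forallP => i; apply/implyP; rewrite leqNgt ltn_ord.
case: (ex_minnP exP) => m /forallP Pm mmin.
have y_gt1 (i : 'I_n) : (m <= i)%N -> 1 < y i by apply/implyP.
have y_1 (i : 'I_n) : (i < m)%N -> y i = 1.
  move=> im; apply/le_anti; rewrite x1 andbT leNgt; apply/negP => yi.
  have : (m <= i)%N; last by rewrite leqNgt im.
  apply: mmin; apply/forallP => j; apply/implyP => ij.
  exact: lt_le_trans (mono _ _ ij).
have tail_eq k : (m <= k)%N -> tail_sum y k = tail_sum B k.
  move=> mk; have [nk|kn] := leqP n k; first by rewrite !tail_sum_geq.
  apply/le_anti; rewrite tail_sum_le 1?ltnW //=.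
  pose q := Ordinal kn; have yq := y_gt1 q mk.
  have [km|neqkm] := eqVneq k m.
    (* Since [y q > 1], the tight row that changes is that of a set containing [s q], so its tail
       starts at or before [k]. The entries before [k] are 1, hence at most [B], and the tail from
       [k] must reach its own bound. *)
    have [|t tt] := moving (basis_vec R (s q)).
      by apply/negP => /eqP /colP /(_ (s q)); rewrite !mxE !eqxx; apply/eqP/oner_neq0.
    case: t tt => [i|I]; rewrite /tight ?facet_rowl ?facet_rowr /=.
      rewrite eqr_opp oppr_eq0 mxE andbT => /eqP xi.
      have [e|] := eqVneq i (s q); last by rewrite eqxx.
      by move: yq; rewrite /y -e xi ltxx.
    move=> /eqP tI; rewrite sum_basis_vec pnatr_eq0 eqb0 negbK => qI.
    have [tk /(_ q)] := tight_set_tail Qx mono tI.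
    rewrite qI => /esym lek.
    have := tail_sum_split y lek; have := tail_sum_split B lek; rewrite /=.
    have : \sum_(i < n | (n - #|I| <= i < k)%N) y i <=
           \sum_(i < n | (n - #|I| <= i < k)%N) B i.
      by apply: ler_sum => i /andP [_ ik]; rewrite y_1 // -km.
    by rewrite -/y in tk; lra.
  have mk' : (m < k)%N by rewrite ltn_neqAle eq_sym neqkm.
  have k'n : (k.-1 < n)%N by apply: leq_ltn_trans (leq_pred k) kn.
  pose p := Ordinal k'n; have k_gt0 : (0 < k)%N by apply: leq_ltn_trans mk'; rewrite leq0n.
  have pq : s p != s q.
    by rewrite (inj_eq perm_inj) -val_eqE /= neq_ltn prednK // leqnn.
  have yp : 1 < y p by apply: y_gt1; rewrite /= -ltnS prednK.
  (* Both coordinates exceed 1, so the tight row that changes belongs to a set containing exactly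
     one of [s p] and [s q]; being a tail, it starts at [k]. *)
  have [|t tt] := moving (basis_vec R (s q) - basis_vec R (s p)).
    apply/negP => /eqP /colP /(_ (s q)); rewrite !mxE !eqxx eq_sym (negPf pq) subr0.
    exact/eqP/oner_neq0.
  case: t tt => [i|I]; rewrite /tight ?facet_rowl ?facet_rowr /=.
    rewrite eqr_opp oppr_eq0 !mxE !andbT => /eqP xi.
    have [e|_] := eqVneq i (s q); first by move: yq; rewrite /y -e xi ltxx.
    have [e|_] := eqVneq i (s p); first by move: yp; rewrite /y -e xi ltxx.
    by rewrite subrr eqxx.
  move=> /eqP tI nz; have [tk sI] := tight_set_tail Qx mono tI.
  suff e : (n - #|I|)%N = k by rewrite -e.
  have sumD : \sum_(i in I) (basis_vec R (s q) - basis_vec R (s p) : 'cV[R]_n) i 0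
      = (s q \in I)%:R - (s p \in I)%:R.
    by rewrite -!sum_basis_vec -sumrB; apply: eq_bigr => i _; rewrite !mxE.
  move: nz; rewrite sumD !sI /=.
  have [jk|kj] := leqP (n - #|I|) k; have [jk'|kj'] := leqP (n - #|I|) k.-1.
  - by rewrite subrr eqxx.
  - by move=> _; apply/eqP; rewrite eqn_leq jk /= -(prednK k_gt0).
  - by move: (leq_trans jk' (leq_pred k)); rewrite leqNgt kj.
  - by rewrite subrr eqxx.
exists s, m; apply/colP => j; rewrite -[j](permKV s); move: ((s^-1)%g j) => i.
rewrite greedy_pointE -/(y i); have [mi|] := leqP m i; last by move/y_1.
have := tail_sum_recl y i; have := tail_sum_recl B i.
by rewrite !tail_eq 1?leqW //; lra.
Qed.

End BoxedPermutohedron.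

(** * Facets and vertices *)

Section FacetsAndVertices.
Local Open Scope classical_set_scope.
Local Open Scope ring_scope.
Variables (R : realType) (n : nat) (B : 'I_n -> R).
Hypotheses (B_ge1 : forall i, 1 <= B i)
  (B_incr : forall i j : 'I_n, (i < j)%N -> B i + 1 <= B j).
Implicit Types (x g : 'cV[R]_n) (s : 'S_n) (I J : {set 'I_n}).

Lemma greedy_polytope_sub_convex (C : set 'cV[R]_n) : @convex_set R 'cV[R]_n C ->
  (forall s m, C (greedy_point B s m)) -> greedy_polytope B `<=` C.
Proof.
move=> cC gC; apply: basic_points_generate => // [g g0|x Qx bx]; last first.
  by have [s [m ->]] := basic_point_greedy B_ge1 B_incr Qx bx.
(* Boundedness: a coordinate is bounded above by its singleton row and below by 1. *)
have [i gi] : exists i, g i 0 != 0.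
  apply/existsP; apply: contraR g0; rewrite negb_exists => /forallP g0.
  by apply/eqP/colP => i; rewrite mxE; apply/eqP; have := g0 i; rewrite negbK.
have [gt0|] := ltP 0 (g i 0).
  by exists (inr [set i]%SET); rewrite facet_rowr big_set1.
by exists (inl i); rewrite facet_rowl oppr_gt0 lt_neqAle gi.
Qed.

Lemma vertex_greedy x : vertex (greedy_polytope B) x -> exists s m, x = greedy_point B s m.
Proof.
move=> vx; have [Qx _] := vx.
by apply: (basic_point_greedy B_ge1 B_incr Qx); apply: vertex_basic_point.
Qed.

Lemma vertex_greedy_ones s : vertex (greedy_polytope B) (greedy_point B s n).
Proof.
split; first exact: greedy_point_in_polytope.
exists (- const_mx 1) => x /greedy_polytopeP [x1 _] ne.
have e y : ((- const_mx 1 : 'rV[R]_n) *m y) 0 0 = - \sum_i y i 0.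
  by rewrite mulNmx !mxE; congr (- _); apply: eq_bigr => i _; rewrite mxE mul1r.
rewrite !e ltrN2.
have le i : i \in 'I_n -> greedy_point B s n i 0 <= x i 0.
  by move=> _; rewrite mxE ltn_ord.
rewrite lt_neqAle ler_sum ?andbT //.
apply/negP => /eqP /esym /eqP; rewrite -subr_eq0 -sumrB => /eqP s0; apply: ne.
apply/colP => i; apply/eqP; rewrite -subr_eq0; apply/eqP.
by apply: (psumr_eq0P _ s0) => // j _; rewrite subr_ge0 le.
Qed.

(** The functional with weights 1, ..., n is the sum of all tail sums. It is maximal only if every
    tail sum reaches its bound, which determines the point. *)
Lemma vertex_greedy_top : vertex (greedy_polytope B) (greedy_point B 1%g 0).
Proof.
split; first exact: greedy_point_in_polytope.
pose c : 'rV[R]_n := \sum_(k < n) \row_j (k <= j)%N%:R.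
exists c => x Qx ne.
have e y : (c *m y) 0 0 = \sum_(k < n) tail_sum (fun i => y i 0) k.
  rewrite mulmx_suml summxE; apply: eq_bigr => k _.
  rewrite mxE [RHS]big_mkcond; apply: eq_bigr => i _.
  by rewrite mxE; case: (k <= i)%N; rewrite ?mul1r ?mul0r.
have tw k : tail_sum (fun i => greedy_point B 1%g 0 i 0) k = tail_sum B k.
  by apply: eq_bigr => i _; rewrite mxE invg1 perm1.
have le (k : 'I_n) : tail_sum (fun i => x i 0) k <= tail_sum B k.
  have := tail_sum_le 1%g Qx (ltnW (ltn_ord k)).
  by under [X in X <= _]eq_bigr do rewrite perm1.
rewrite !e; under [X in _ < X]eq_bigr do rewrite tw.
rewrite lt_neqAle ler_sum ?andbT //.
apply/negP => /eqP /esym /eqP; rewrite -subr_eq0 -sumrB => /eqP s0; apply: ne.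
have tE k : tail_sum (fun i => x i 0) k = tail_sum B k.
  have [nk|kn] := leqP n k; first by rewrite !tail_sum_geq.
  apply/esym/eqP; rewrite -subr_eq0; apply/eqP.
  have := @psumr_eq0P _ _ _ _ _ s0 (Ordinal kn) isT; apply => j _.
  by rewrite subr_ge0 le.
apply/colP => i; rewrite [RHS]mxE invg1 perm1 /=.
have := tail_sum_recl B i; have := tail_sum_recl (fun i => x i 0) i.
by rewrite !tE; lra.
Qed.

(** * The minimal inequality description and the root circuits *)

Lemma sum_interval_const (c : R) k m : (k <= m)%N -> (m <= n)%N ->
  \sum_(i < n | (k <= i < m)%N) c = (m - k)%:R * c.
Proof.
move=> km mn.
have := tail_sum_split ((fun=> 1) : 'I_n -> R) km.
rewrite !tail_sum1 !natrB //; last exact: leq_trans mn.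
move=> e; transitivity ((\sum_(i < n | (k <= i < m)%N) 1) * c); last first.
  by congr (_ * _); lra.
by rewrite mulr_suml; apply: eq_bigr => i _; rewrite mul1r.
Qed.

(** The rank function: the bound on the sum over any [l] coordinates. *)
Let top l := tail_sum B (n - l).

Let top_split k l : (k <= l)%N -> (l <= n)%N ->
  top l = \sum_(i < n | (n - l <= i < n - k)%N) B i + top k.
Proof. by move=> kl ln; apply: tail_sum_split; rewrite leq_sub2l. Qed.

Let sub_sub k l : (k <= l)%N -> (l <= n)%N -> ((n - k) - (n - l) = l - k)%N.
Proof. lia. Qed.

Lemma top_gap k l : (k <= l)%N -> (l <= n)%N -> top k + (l - k)%:R <= top l.
Proof.
move=> kl ln; rewrite (top_split kl ln) addrC lerD2r.
rewrite -(sub_sub kl ln) -[X in X <= _]mulr1 -sum_interval_const ?leq_subr ?leq_sub2l //.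
exact: ler_sum.
Qed.

(** The largest added value is at least 2: it lies above the first value of [B], except for
    [k = n - 1], where it is that value and the hypothesis applies. *)
Lemma top_strict_gap (n_gt0 : (0 < n)%N) k l : (k < l)%N -> (l <= n)%N ->
  (k == n.-1) ==> (2 <= B (Ordinal n_gt0)) -> top k + (l - k)%:R + 1 <= top l.
Proof.
move=> kl ln hk; apply: le_trans (top_gap kl ln).
have qn : (n - k.+1 < n)%N by rewrite ltn_subrL.
have Bq : 2 <= B (Ordinal qn).
  have [e|ne] := eqVneq k n.-1.
    have -> : Ordinal qn = Ordinal n_gt0.
      by apply: val_inj; rewrite /= e prednK // subnn.
    by move: hk; rewrite e eqxx.
  have := @B_incr (Ordinal n_gt0) (Ordinal qn).
  have -> : (Ordinal n_gt0 < Ordinal qn)%N by rewrite /=; lia.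
  by move=> /(_ isT); have := B_ge1 (Ordinal n_gt0); lra.
have := tail_sum_recl B (Ordinal qn); rewrite /= subnSK ?(leq_trans kl) //.
rewrite -/(top _) -/(top _) => ->.
by rewrite -[in X in X <= _](subnSK kl) -addn1 natrD; lra.
Qed.

(** Strict concavity in terms of means. If [beta] is the least of the [r] largest values, then
    [top r >= r * beta], while each of the next [k - r] values is at most [beta - 1]. *)
Lemma top_average r k : (0 < r)%N -> (r < k)%N -> (k <= n)%N ->
  r%:R * top k + r%:R * (k - r)%:R <= k%:R * top r.
Proof.
move=> r_gt0 rk kn; have rn := leq_trans (ltnW rk) kn.
have qn : (n - r < n)%N by lia.
set beta := B (Ordinal qn).
have lower : r%:R * beta <= top r.
  have := @ler_tail_sum R n (fun=> beta) B (n - r) _.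
  have -> : tail_sum ((fun=> beta) : 'I_n -> R) (n - r) = r%:R * beta :> R.
    transitivity (tail_sum ((fun=> 1) : 'I_n -> R) (n - r) * beta).
      by rewrite mulr_suml; apply: eq_bigr => i _; rewrite mul1r.
    by rewrite tail_sum1 subKn.
  by apply=> i ri; apply: B_mono.
have upper : top k - top r <= (k - r)%:R * (beta - 1).
  rewrite (top_split (ltnW rk) kn) addrK -(sub_sub (ltnW rk) kn).
  rewrite -sum_interval_const ?leq_subr ?leq_sub2l 1?ltnW //.
  apply: ler_sum => i /andP [_ ir].
  by have := @B_incr i (Ordinal qn) ir; rewrite -/beta; lra.
move: upper lower; rewrite natrB 1?ltnW //.
have : (r%:R : R) + 1 <= k%:R by rewrite natr1 ler_nat.
have : (1 : R) <= r%:R by rewrite ler1n.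
move: (top k) (top r) => tk tr h1 h2 upper lower.
have := ler_wpM2l (le_trans ler01 h1) upper.
have : 0 <= (k%:R : R) - r%:R by lra.
move=> h3; have := ler_wpM2l h3 lower; lra.
Qed.

Lemma card_le_n I : (#|I| <= n)%N.
Proof. by rewrite -[n in (_ <= n)%N]card_ord max_card. Qed.

Variable n_gt0 : (0 < n)%N.
Hypothesis B0 : B (Ordinal n_gt0) = 1 \/ 2 <= B (Ordinal n_gt0).

Definition irredundant (t : 'I_n + {set 'I_n}) : bool :=
  match t with
  | inl _ => true
  | inr J => (0 < #|J|)%N && ((#|J| == n.-1) ==> (2 <= B (Ordinal n_gt0)))
  end.

(** The empty set gives [0 <= 0]. If the first value of [B] is 1, the bound for all but the
    coordinate [j] follows from the bound on the full sum and [1 <= x j 0]. *)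
Lemma irredundant_greedy_polytope x :
  (forall t, irredundant t -> (facet_row R t *m x) 0 0 <= facet_bound B t) ->
  greedy_polytope B x.
Proof.
move=> H; apply/greedy_polytopeP.
have x1 i : 1 <= x i 0 by have := H (inl i) isT; rewrite facet_rowl lerN2.
split=> // J; have := H (inr J); rewrite facet_rowr /= -/(top _).
have [J0 _|J_gt0] := posnP #|J|.
  by rewrite (cards0_eq J0) big_set0 cards0 /top tail_sum_geq // subn0.
have [cJ|] := eqVneq #|J| n.-1; last by move=> _; apply.
case: B0 => [B1 _|->]; last by apply.
have [j jJ] : exists j, ~: J = [set j]%SET.
  by apply/cards1P; rewrite cardsCs finset.setCK card_ord cJ; lia.
have := H (inr [set: 'I_n]%SET); rewrite facet_rowr /= cardsT card_ord n_gt0 subnn.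
have -> : (n == n.-1) = false by apply/eqP; lia.
move/(_ isT); rewrite (bigID (fun i => i \in J)) /=.
have -> : \sum_(i in [set: 'I_n]%SET | i \notin J) x i 0 = x j 0.
  transitivity (\sum_(i in [set j]%SET) x i 0); last by rewrite big_set1.
  by rewrite -jJ; apply: eq_bigl => i; rewrite !inE.
rewrite (eq_bigl (fun i => i \in J)) => [|i]; last by rewrite inE.
have := tail_sum_recl B (Ordinal n_gt0); rewrite /= B1 /top cJ.
have -> : (n - n.-1 = 1)%N by lia.
by have := x1 j; lra.
Qed.

(* Beyond the facet of [J]: a constant slightly above the mean [top k / k] on [J]
   and 1 elsewhere. The margin [1 / k^2] is harmless because [top r / r] exceeds
   [top k / k] by at least [1 / k] for [r < k]. *)
Lemma violating_point t : irredundant t -> exists x : 'cV[R]_n,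
  facet_bound B t < (facet_row R t *m x) 0 0 /\
  forall t', irredundant t' -> t' != t ->
    (facet_row R t' *m x) 0 0 <= facet_bound B t'.
Proof.
case: t => [i _|J /andP [J_gt0 hJ]].
  exists (\col_j (j != i)%:R); rewrite facet_rowl mxE eqxx /= oppr0 ltrN10.
  split=> // -[j _ ji|J _ _].
    rewrite facet_rowl mxE; have -> : j != i by apply: contraNneq ji => ->.
    by [].
  rewrite facet_rowr /= -/(top _).
  have := top_gap (leq0n #|J|) (card_le_n J).
  rewrite subn0 {1}/top tail_sum_geq ?subn0 // add0r; apply: le_trans.
  rewrite -sum1_card natr_sum; apply: ler_sum => j _.
  by rewrite mxE; case: (j != i).
set k := #|J| in J_gt0 hJ *.
have k_gt0 : 0 < k%:R :> R by rewrite ltr0n.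
have kn : (k <= n)%N by apply: card_le_n.
pose a : R := (k%:R * top k + 1) / k%:R ^+ 2.
exists (\col_j (if j \in J then a else 1)).
have sum_x (L : {set 'I_n}) : \sum_(i in L) (\col_j (if j \in J then a else 1) : 'cV[R]_n) i 0
    = #|L :&: J|%:R * a + (#|L| - #|L :&: J|)%:R.
  rewrite (big_setID J) /=; congr (_ + _).
    rewrite mulrC mulr_natr -sumr_const; apply: eq_bigr => i.
    by rewrite inE mxE => /andP [_ ->].
  rewrite -cardsD -sum1_card natr_sum; apply: eq_bigr => i.
  by rewrite inE mxE => /andP [/negPf ->].
have ka : k%:R * a = top k + k%:R^-1.
  by rewrite /a; field; rewrite gt_eqF.
have kV1 : k%:R^-1 <= 1 :> R by rewrite invf_le1 // ler1n.
have kV0 : 0 < k%:R^-1 :> R by rewrite invr_gt0.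
split.
  rewrite facet_rowr sum_x finset.setIid -/k subnn addr0 ka /= -/(top _) -/k.
  by rewrite ltrDl.
move=> [i _ _|L /andP [L_gt0 _] LJ].
  rewrite facet_rowl mxE /= lerN2; case: ifP => // _.
  have := top_gap (leq0n k) kn.
  rewrite subn0 {1}/top tail_sum_geq ?subn0 // add0r => ktop.
  have : k%:R * 1 <= k%:R * a by rewrite ka; lra.
  by rewrite ler_pM2l.
(* If [L] misses [J], its coordinates are all 1; if it strictly contains [J], the strict gap absorbs
   the excess [1 / k]; otherwise the comparison of means does. *)
rewrite facet_rowr sum_x /= -/(top _); set r := #|L :&: J|; set l := #|L|.
have rk : (r <= k)%N by rewrite subset_leq_card // finset.subsetIr.
have rl : (r <= l)%N by rewrite subset_leq_card // finset.subsetIl.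
have ln : (l <= n)%N by apply: card_le_n.
have [r0|r_gt0] := posnP r.
  have := top_gap (leq0n l) ln.
  by rewrite r0 mul0r add0r {1}/top tail_sum_geq ?subn0 // add0r.
have [erk|nrk] := eqVneq r k.
  have JL : J \subset L.
    apply/finset.setIidPr/eqP; rewrite eqEcard finset.subsetIr /=.
    by rewrite -/r erk leqnn.
  have kl : (k < l)%N.
    apply: proper_card; rewrite finset.properEneq JL andbT; apply: contraNneq LJ => ->.
    by [].
  rewrite erk ka; have := top_strict_gap kl ln hJ; lra.
have rk' : (r < k)%N by rewrite ltn_neqAle nrk.
apply: le_trans (top_gap rl ln); rewrite lerD2r /a mulrA ler_pdivrMr ?exprn_gt0 //.
have := top_average r_gt0 rk' kn; rewrite natrB //.
have : (r%:R : R) + 1 <= k%:R by rewrite natr1 ler_nat.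
have : (1 : R) <= r%:R by rewrite ler1n.
move: (top k) (top r) => tk tr h1 h2 h3.
have h4 := ler_wpM2l (ltW k_gt0) h3.
have h5 : (r%:R : R) <= k%:R * (r%:R * (k%:R - r%:R)).
  have : (r%:R : R) * 1 <= r%:R * (k%:R * (k%:R - r%:R)).
    by apply: ler_wpM2l; nra.
  by lra.
lra.
Qed.

Definition facet_matrix : 'M[R]_(#|irredundant|, n) :=
  \matrix_(k, j) facet_row R (enum_val k) 0 j.

Definition facet_column : 'cV[R]_#|irredundant| :=
  \col_k facet_bound B (enum_val k).

Lemma facet_matrixE k x :
  (facet_matrix *m x) k 0 = (facet_row R (enum_val k) *m x) 0 0.
Proof. by rewrite !mxE; apply: eq_bigr => j _; rewrite mxE. Qed.

Lemma facet_matrix_minimal :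
  minimal_description (greedy_polytope B) facet_matrix facet_column.
Proof.
split.
  apply/seteqP; split=> [x Qx k|x sx].
    by rewrite facet_matrixE [X in _ <= X]mxE; apply: Qx.
  apply: irredundant_greedy_polytope => t tI.
  have := sx (enum_rank_in tI t); rewrite facet_matrixE [X in _ <= X]mxE.
  by rewrite enum_rankK_in.
move=> k e.
have [x [viol sat]] := violating_point (enum_valP k).
have : solutions (row' k facet_matrix) (row' k facet_column) x.
  move=> j.
  have -> : (row' k facet_matrix *m x) j 0 = (facet_matrix *m x) (lift k j) 0.
    by rewrite !mxE; apply: eq_bigr => i _; rewrite !mxE.
  rewrite facet_matrixE [X in _ <= X]mxE [X in _ <= X]mxE; apply: sat; first exact: enum_valP.
  by apply/eqP => /enum_val_inj /eqP; rewrite eq_sym (negPf (neq_lift _ _)).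
by rewrite e => /(_ (enum_val k)); rewrite leNgt viol.
Qed.

(** It suffices that the irredundant rows vanishing on [g] have the line of [g] as common kernel.
    The lower bounds of the coordinates outside [g] achieve this for a signed basis vector; for a
    difference of two, the full sum is added. *)
Lemma root_direction_circuit g : root_direction g -> circuit (greedy_polytope B) g.
Proof.
have cn : [set: 'I_n]%SET \in [pred J | irredundant (inr J)].
  rewrite inE /= cardsT card_ord n_gt0 /=.
  by have -> : (n == n.-1) = false by apply/eqP; lia.
have minimal (h : 'cV[R]_n) : h != 0 ->
    (forall y, (forall t, irredundant t -> (facet_row R t *m h) 0 0 = 0 ->
                 (facet_row R t *m y) 0 0 = 0) -> exists c, y = c *: h) ->
    circuit (greedy_polytope B) h.
  move=> h0 span; split=> //.
  exists #|irredundant|, facet_matrix, facet_column.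
  split=> [|y y0]; first exact: facet_matrix_minimal.
  apply/negP => /properP [/fintype.subsetP sub [k]].
  rewrite !inE => hk yk.
  have [c ec] : exists c, y = c *: h.
    apply: span => t tI /eqP ht; apply/eqP; apply: contraTT ht => yt.
    have := sub (enum_rank_in tI t); rewrite !inE !facet_matrixE.
    by rewrite enum_rankK_in //; apply.
  move: yk; rewrite ec -scalemxAr mxE mulf_eq0 (negPf hk) orbF => /negPn /eqP c0.
  by move: y0; rewrite ec c0 scale0r eqxx.
case=> [[i gi]|[i [j [/eqP ij ->]]]].
  apply: minimal.
    case: gi => ->; rewrite ?oppr_eq0; apply/eqP => /colP /(_ i);
      by rewrite !mxE !eqxx; apply/eqP/oner_neq0.
  move=> y Hy.
  have y0 j : j != i -> y j 0 = 0.
    move=> ji; have := Hy (inl j) isT; rewrite !facet_rowl => H.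
    apply/eqP; rewrite -oppr_eq0 H //.
    by case: gi => ->; rewrite !mxE (negPf ji) ?oppr0.
  case: gi => ->; [exists (y i 0)|exists (- y i 0)]; apply/colP => j; rewrite !mxE andbT;
    by have [->|ji] := eqVneq j i; rewrite /= ?(y0 _ ji); ring.
apply: minimal.
  apply/eqP => /colP /(_ i); rewrite !mxE !eqxx (negPf ij) subr0.
  by apply/eqP/oner_neq0.
move=> y Hy.
have y0 k : k != i -> k != j -> y k 0 = 0.
  move=> ki kj; have := Hy (inl k) isT; rewrite !facet_rowl => H.
  by apply/eqP; rewrite -oppr_eq0 H // !mxE (negPf ki) (negPf kj) subr0 oppr0.
have sum2 (z : 'cV[R]_n) : (forall k, k != i -> k != j -> z k 0 = 0) ->
    \sum_(k in [set: 'I_n]%SET) z k 0 = z i 0 + z j 0.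
  move=> z0; rewrite (bigD1 i) ?inE //=; congr (_ + _).
  rewrite (bigD1 j) ?inE 1?eq_sym //= big1 ?addr0 // => k /andP [/andP [_ ki] kj].
  exact: z0.
have := Hy (inr [set: 'I_n]%SET) cn; rewrite !facet_rowr !sum2 //; last first.
  by move=> k ki kj; rewrite !mxE (negPf ki) (negPf kj) subr0.
rewrite !mxE !eqxx (negPf ij) eq_sym (negPf ij) subr0 sub0r subrr => /(_ erefl) yij.
exists (y i 0); apply/colP => k; rewrite !mxE !andbT.
have [->|ki] := eqVneq k i; first by rewrite (negPf ij) subr0 mulr1.
have [->|kj] := eqVneq k j; first by rewrite sub0r mulrN1; lra.
by rewrite subr0 mulr0 y0.
Qed.

End FacetsAndVertices.

(** * Circuit walks *)

Section Walks.
Local Open Scope classical_set_scope.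
Local Open Scope ring_scope.
Variables (R : realType) (n : nat) (P D : set 'cV[R]_n).

Lemma walk0 u : P u -> walk P D 0 u u.
Proof. by move=> Pu; exists (fun=> u); split. Qed.

Lemma walk_cons t g u v w : P u -> D g -> maximal_step P g u v ->
  walk P D t v w -> walk P D t.+1 u w.
Proof.
move=> Pu Dg guv [x [x0 xt Px step]].
exists (fun k => if k is k'.+1 then x k' else u); split=> //.
  by case=> [//|k]; exact: Px.
case=> [_|k]; last exact: step.
by exists g => //; rewrite x0.
Qed.

Lemma walk_distance_exists N u w : (exists2 t, walk P D t u w & (t <= N)%N) ->
  exists2 t, walk_distance P D u w t & (t <= N)%N.
Proof.
case=> t0 W0 t0N.
have exW : exists t, `[< walk P D t u w >] by exists t0; apply/asboolP.
case: (ex_minnP exW) => t /asboolP W tmin.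
exists t; last by apply: leq_trans t0N; apply: tmin; apply/asboolP.
by split=> // s Ws; apply: tmin; apply/asboolP.
Qed.

(** The distances between vertices are at most [N], and [u0] makes their set nonempty, so a maximum
    exists. *)
Lemma walk_diameter_exists N u0 : vertex P u0 ->
  (forall u w, vertex P u -> vertex P w ->
     exists2 t, walk P D t u w & (t <= N)%N) ->
  exists2 k, walk_diameter P D k & (k <= N)%N.
Proof.
move=> vu0 short.
pose attained k := `[< exists u w,
  [/\ vertex P u, vertex P w & walk_distance P D u w k] >].
have dist u w : vertex P u -> vertex P w ->
    exists2 t, walk_distance P D u w t & (t <= N)%N.
  by move=> vu vw; apply: walk_distance_exists; apply: short.
have exA : exists k, attained k.
  have [t dt _] := dist _ _ vu0 vu0.
  by exists t; apply/asboolP; exists u0, u0.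
have leN k : attained k -> (k <= N)%N.
  move=> /asboolP [u [w [vu vw [_ kmin]]]].
  by have [t [Wt _] tN] := dist _ _ vu vw; apply: leq_trans tN; apply: kmin.
case: (ex_maxnP exA leN) => k /asboolP kA kmax.
exists k; last by apply: leN; apply/asboolP.
split=> // u w vu vw; have [t dt tN] := dist _ _ vu vw.
by exists t => //; apply: kmax; apply/asboolP; exists u, w.
Qed.

Lemma walk_diameter_attained N u0 w0 :
  (forall u w, vertex P u -> vertex P w ->
     exists2 t, walk P D t u w & (t <= N)%N) ->
  vertex P u0 -> vertex P w0 -> (forall t, walk P D t u0 w0 -> (N <= t)%N) ->
  walk_diameter P D N.
Proof.
move=> short vu vw long; split=> [u w vu' vw'|].
  by apply: walk_distance_exists; apply: short.
exists u0, w0; split=> //; split=> //.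
have [t Wt tN] := short _ _ vu vw.
by have /eqP <- : t == N; rewrite // eqn_leq tN long.
Qed.

End Walks.

(** * Short walks between greedy points *)

Section GreedyWalks.
Local Open Scope classical_set_scope.
Local Open Scope ring_scope.
Variables (R : realType) (n : nat) (B : 'I_n -> R).
Hypotheses (B_ge1 : forall i, 1 <= B i)
  (B_incr : forall i j : 'I_n, (i < j)%N -> B i + 1 <= B j).
Variable D : set 'cV[R]_n.
Hypothesis rootD : forall g, root_direction g -> D g.
Implicit Types (x g : 'cV[R]_n) (s : 'S_n).

(** A row that is tight at the end of the step and increases along [g] blocks any longer step. *)
Lemma maximal_step_facet t g x (l : R) : 0 < l ->
  tight (@facet_row R n) (facet_bound B) (x + l *: g) t ->
  0 < (facet_row R t *m g) 0 0 -> maximal_step (greedy_polytope B) g x (x + l *: g).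
Proof.
move=> l_gt0; rewrite /tight mulmx_line => /eqP e gt0; exists l => //.
split=> // l' ll' /(_ t); rewrite mulmx_line -e; nra.
Qed.

(** The indices below [m] all carry the value 1, so their arrangement is immaterial. *)
Lemma greedy_point_eq s s' m :
  (forall i : 'I_n, (m <= i)%N -> s i = s' i) ->
  greedy_point B s m = greedy_point B s' m.
Proof.
move=> e; apply/colP => j; rewrite -[j](permKV s); move: ((s^-1)%g j) => i.
rewrite greedy_pointE; have [mi|im] := leqP m i.
  by rewrite e // greedy_pointE ltnNge mi.
rewrite mxE; case: ifP => // /negbT; rewrite -leqNgt => mj.
have := e _ mj; rewrite permKV => /perm_inj ij.
by move: mj; rewrite ij leqNgt im.
Qed.

Lemma tight_tail s m k : (m <= k)%N -> (k <= n)%N ->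
  tight (@facet_row R n) (facet_bound B) (greedy_point B s m)
    (inr [set j | (k <= (s^-1)%g j)%N]%SET).
Proof.
move=> mk kn; rewrite /tight facet_rowr -tail_sum_perm /= card_tail_set // subKn //.
apply/eqP; apply: eq_bigr => i ki.
by rewrite greedy_pointE ltnNge (leq_trans mk ki).
Qed.

(** Index [p] carries 1 or [B p], in either case less than [B q]; moving the difference from [s q]
    to [s p] exchanges the two values. *)
Lemma swap_step s m (p q : 'I_n) : (p < q)%N -> (m <= q)%N ->
  exists2 g, root_direction g &
    maximal_step (greedy_polytope B) g (greedy_point B s m) (greedy_point B (tperm p q * s)%g m).
Proof.
move=> pq mq; set s' := (tperm p q * s)%g.
pose v (i : 'I_n) : R := if (i < m)%N then 1 else B i.
pose g : 'cV[R]_n := basis_vec R (s p) - basis_vec R (s q).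
have vq : v q = B q by rewrite /v ltnNge mq.
have npq : p != q by rewrite -val_eqE ltn_eqF.
have sE i : s i = s' (tperm p q i) by rewrite permM tpermK.
have l_gt0 : 0 < B q - v p.
  have := B_incr pq; have := B_ge1 p; rewrite /v; case: ifP => _; lra.
exists g; first by right; exists (s p), (s q); split=> //; move/perm_inj/eqP; rewrite (negPf npq).
have x1 i : greedy_point B s m (s i) 0 = v i by rewrite greedy_pointE.
have x2 i : greedy_point B s' m (s i) 0 = v (tperm p q i).
  by rewrite sE greedy_pointE.
have e : greedy_point B s m + (B q - v p) *: g = greedy_point B s' m.
  apply/colP => j; rewrite -[j](permKV s); move: ((s^-1)%g j) => i.
  rewrite x2 mxE x1 !mxE !andbT !(inj_eq perm_inj) -vq.
  case: tpermP => [->|->|/eqP ip /eqP iq].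
  - by rewrite eqxx (negPf npq) /=; ring.
  - by rewrite eqxx eq_sym (negPf npq) /=; ring.
  by rewrite (negPf ip) (negPf iq) /=; ring.
rewrite -e.
(* The [n - q] largest coordinates now form a tight set that contains [s p]
   but not [s q]. *)
apply: (@maximal_step_facet (inr [set j | (q <= (s'^-1)%g j)%N]%SET)) => //.
  by rewrite e; apply: tight_tail => //; apply: ltnW.
rewrite facet_rowr.
have -> : \sum_(i in [set j | (q <= (s'^-1)%g j)%N]%SET) g i 0 = 1; last by [].
have sumD (I : {set 'I_n}) : \sum_(i in I) g i 0
    = (s p \in I)%:R - (s q \in I)%:R.
  by rewrite -!sum_basis_vec -sumrB; apply: eq_bigr => i _; rewrite !mxE.
rewrite sumD !inE (sE p) (sE q) !permK tpermL tpermR leqnn leqNgt pq.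
by rewrite subr0.
Qed.

Lemma greedy_pointS s (p : 'I_n) :
  greedy_point B s p = greedy_point B s p.+1 + (B p - 1) *: basis_vec R (s p).
Proof.
apply/colP => j; rewrite -[j](permKV s); move: ((s^-1)%g j) => i.
rewrite greedy_pointE [RHS]mxE greedy_pointE !mxE andbT (inj_eq perm_inj) ltnS.
rewrite -val_eqE /=; case: ltngtP => [_|_|/val_inj ->] /=; ring.
Qed.

Lemma raise_step s (p : 'I_n) : 1 < B p ->
  exists2 g, root_direction g &
    maximal_step (greedy_polytope B) g (greedy_point B s p.+1) (greedy_point B s p).
Proof.
move=> Bp; exists (basis_vec R (s p)); first by left; exists (s p); left.
rewrite greedy_pointS.
apply: (@maximal_step_facet (inr [set j | (p <= (s^-1)%g j)%N]%SET)).
- by rewrite subr_gt0.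
- by rewrite -greedy_pointS; apply: tight_tail => //; apply: ltnW.
by rewrite facet_rowr sum_basis_vec inE permK leqnn.
Qed.

Lemma lower_step s (p : 'I_n) : 1 < B p ->
  exists2 g, root_direction g &
    maximal_step (greedy_polytope B) g (greedy_point B s p) (greedy_point B s p.+1).
Proof.
move=> Bp; exists (- basis_vec R (s p)); first by left; exists (s p); right.
have e : greedy_point B s p.+1 = greedy_point B s p + (B p - 1) *: - basis_vec R (s p).
  by rewrite greedy_pointS scalerN addrK.
rewrite e; apply: (@maximal_step_facet (inl (s p))).
- by rewrite subr_gt0.
- by rewrite -e /tight facet_rowl greedy_pointE ltnSn.
by rewrite facet_rowl !mxE !eqxx opprK.
Qed.

(** The number of indices at which [B] is 1, in the end 1 or 0 according to whether b_1 is 1; these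
    indices never cost a step. *)
Variable delta : nat.
Hypothesis B_gt1 : forall i : 'I_n, (delta <= i)%N -> 1 < B i.

Lemma lower_walk s m m' : (delta <= m)%N -> (m <= m')%N -> (m' <= n)%N ->
  walk (greedy_polytope B) D (m' - m) (greedy_point B s m) (greedy_point B s m').
Proof.
move=> dm mm' m'n; move e: (m' - m)%N => t; elim: t m dm mm' e => [|t IH] m dm mm' e.
  have -> : m' = m by apply/eqP; rewrite eqn_leq mm' -subn_eq0 e.
  by apply: walk0; apply: greedy_point_in_polytope.
have mn : (m < n)%N by lia.
have [g rg st] := @lower_step s (Ordinal mn) (@B_gt1 (Ordinal mn) dm).
apply: (walk_cons _ (rootD rg) st); first exact: greedy_point_in_polytope.
by apply: IH; rewrite /=; lia.
Qed.

(* Coordinates [s' i] are settled from the top index down; [k] bounds the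
   indices still to be treated, and each of them costs at most one step. *)
Lemma greedy_walk_exists s' m' k s m :
  (delta <= m')%N -> (m' <= k)%N -> (k <= n)%N ->
  (delta <= m)%N -> (m <= k)%N ->
  (forall i : 'I_n, (k <= i)%N -> s i = s' i) ->
  exists2 t, walk (greedy_polytope B) D t (greedy_point B s m) (greedy_point B s' m')
    & (t <= k - delta)%N.
Proof.
move=> dm' m'k; elim: k m'k s m => [|k0 IH] m'k s m kn dm mk agree.
  exists (m' - m)%N; last by lia.
  have -> : greedy_point B s' m' = greedy_point B s m'.
    by apply: greedy_point_eq => i m'i; rewrite agree.
  by apply: lower_walk => //; lia.
(* If [m' = k0.+1], the large coordinates of the target are settled and the surplus only has to be
   lowered. *)
have [em'|m'k0] : m' = k0.+1 \/ (m' <= k0)%N by lia.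
  exists (m' - m)%N; last by lia.
  have -> : greedy_point B s' m' = greedy_point B s m'.
    by apply: greedy_point_eq => i m'i; rewrite agree // -em'.
  by apply: lower_walk => //; lia.
(* [q] is the highest unsettled index and [p] the index that the current point gives to the
   coordinate [s' q]; exchanging them settles [q]. *)
pose q := Ordinal kn; pose p := (s^-1)%g (s' q).
have sp : s p = s' q by rewrite permKV.
have pq : (p <= q)%N.
  rewrite leqNgt; apply/negP => qp; have := agree p qp.
  by rewrite sp => /perm_inj e; rewrite e ltnn in qp.
set s1 := (tperm p q * s)%g.
have s1q : s1 q = s' q by rewrite permM tpermR.
have s1E (i : 'I_n) : (k0 < i)%N -> s1 i = s i.
  move=> ki; rewrite permM tpermD // -val_eqE neq_ltn ?ki //.
  by rewrite (leq_ltn_trans pq ki).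
have agree1 (i : 'I_n) : (k0 <= i)%N -> s1 i = s' i.
  rewrite leq_eqVlt => /orP [/eqP e|ki]; last by rewrite s1E // agree.
  by have -> : i = q by apply: val_inj.
(* If [m = k0.+1], all unsettled coordinates are 1, so the relabelling to [s1] is free and one raise
   suffices. *)
have [em|mk0] : m = k0.+1 \/ (m <= k0)%N by lia.
  have dk0 : (delta <= k0)%N by lia.
  have -> : greedy_point B s m = greedy_point B s1 m.
    by apply: greedy_point_eq => i mi; rewrite s1E // -em.
  have [g rg st] := raise_step s1 (@B_gt1 q dk0).
  have [t Wt tk] := IH m'k0 s1 k0 (ltnW kn) dk0 (leqnn _) agree1.
  exists t.+1; last by lia.
  rewrite em; apply: (walk_cons _ (rootD rg) st Wt); exact: greedy_point_in_polytope.
have [t Wt tk] := IH m'k0 s1 m (ltnW kn) dm mk0 agree1.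
have [epq|npq] := eqVneq p q.
  exists t; last by lia.
  by move: Wt; rewrite /s1 epq tperm1 mul1g.
have ltpq : (p < q)%N by rewrite ltn_neqAle pq andbT.
have [g rg st] := swap_step s ltpq mk0.
exists t.+1; last by lia.
apply: (walk_cons _ (rootD rg) st Wt); exact: greedy_point_in_polytope.
Qed.

Hypothesis delta_le : (delta <= n)%N.
Hypothesis B_1 : forall i : 'I_n, (i < delta)%N -> B i = 1.

(** Below [delta] the value of [B] is 1 anyway, and no index exceeds [n], so [m] may be moved into
    the range required for the walks. *)
Lemma greedy_point_clip s m : exists2 m0, (delta <= m0 <= n)%N &
  greedy_point B s m = greedy_point B s m0.
Proof.
exists (maxn delta (minn m n)); first by lia.
apply/colP => j; rewrite -[j](permKV s); move: ((s^-1)%g j) => i.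
rewrite !greedy_pointE leq_max leq_min ltn_ord andbT orbC.
by case: ifP => //= _; case: ifP => // /B_1.
Qed.

Lemma short_walk u w : vertex (greedy_polytope B) u -> vertex (greedy_polytope B) w ->
  exists2 t, walk (greedy_polytope B) D t u w & (t <= n - delta)%N.
Proof.
move=> /(vertex_greedy B_ge1 B_incr) [s [m ->]].
move=> /(vertex_greedy B_ge1 B_incr) [s' [m' ->]].
have [m0 /andP [dm mn] ->] := greedy_point_clip s m.
have [m0' /andP [dm' m'n] ->] := greedy_point_clip s' m'.
apply: greedy_walk_exists => // i.
by rewrite leqNgt ltn_ord.
Qed.

End GreedyWalks.

(** * Lower bound *)

Section RootWalkLength.
Local Open Scope classical_set_scope.
Local Open Scope ring_scope.
Variables (R : realType) (n : nat).
Implicit Types (g : 'cV[R]_n) (F : option 'I_n -> option 'I_n).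

(* With [None] an extra node at which all weights vanish, root directions are
   the signed edges of the complete graph on [option 'I_n]. *)
Lemma root_direction_edge g : root_direction g ->
  exists p q : option 'I_n, forall psi : option 'I_n -> R, psi None = 0 ->
    \sum_i psi (Some i) * g i 0 = psi p - psi q.
Proof.
have sumE (psi : option 'I_n -> R) i :
    \sum_j psi (Some j) * (basis_vec R i) j 0 = psi (Some i).
  rewrite (bigD1 i) //= big1 ?addr0 ?mxE ?eqxx ?mulr1 // => j ne.
  by rewrite mxE (negPf ne) mulr0.
case=> [[i [->|->]]|[i [j [_ ->]]]].
- by exists (Some i), None => psi psi0; rewrite sumE psi0 subr0.
- exists None, (Some i) => psi psi0; rewrite psi0 sub0r -sumE -sumrN.
  by apply: eq_bigr => j _; rewrite mxE mulrN.
exists (Some i), (Some j) => psi _; rewrite -!sumE -sumrB.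
by apply: eq_bigr => k _; rewrite !mxE mulrBr.
Qed.

(* [F] labels the connected components of the graph formed by the edges used;
   a displacement sums to zero over every component that avoids [None]. *)
Lemma walk_components P (D : set 'cV[R]_n) t u w :
  (forall g, D g -> root_direction g) -> walk P D t u w ->
  exists F, (n.+1 <= #|F @: [set: option 'I_n]%SET| + t)%N /\
    forall phi : option 'I_n -> R, phi (F None) = 0 ->
      \sum_i phi (F (Some i)) * (w - u) i 0 = 0.
Proof.
move=> rootD [x [<- <- _ step]].
elim: t step => [|t IH] step.
  exists id; rewrite imset_id cardsT card_option card_ord addn0; split=> // phi _.
  by rewrite big1 // => i _; rewrite subrr mxE mulr0.
have [s st|F [cF sF]] := IH; first by apply: step; apply: ltnW.
have [g Dg [l _ [-> _]]] := step t (ltnSn t).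
have [p [q edge]] := root_direction_edge (rootD _ Dg).
(* The new edge merges the component of [p] into that of [q], which costs at most one label. *)
pose h z := if z == F p then F q else z.
exists (h \o F); split=> [|phi phi0].
  apply: leq_trans cF _; rewrite -addSnnS leq_add2r.
  have sub : F @: [set: option 'I_n]%SET \subset
      (F p |: ((h \o F) @: [set: option 'I_n]))%SET.
    apply/fintype.subsetP => _ /imsetP [z _ ->]; rewrite !inE.
    have [//|ne] := eqVneq (F z) (F p); apply/imsetP; exists z; rewrite ?inE //=.
    by rewrite /h (negPf ne).
  apply: (leq_trans (subset_leq_card sub)).
  by rewrite cardsU1 -add1n leq_add2r leq_b1.
have := sF (phi \o h) phi0; have := edge (phi \o h \o F) phi0.
have -> : (phi \o h \o F) p - (phi \o h \o F) q = 0.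
  by rewrite /= /h eqxx; case: eqP => _; rewrite subrr.
move=> e1 e2; transitivity (\sum_i (phi \o h) (F (Some i)) * (x t - x 0) i 0
  + l * \sum_i (phi \o h \o F) (Some i) * g i 0).
  rewrite mulr_sumr -big_split; apply: eq_bigr => i _ /=.
  by rewrite !mxE; ring.
by rewrite e1 e2 mulr0 addr0.
Qed.

(** Over a component avoiding [None] the displacements are nonnegative with sum zero, so its
    coordinates are all fixed. Hence the labels number at most one more than the fixed
    coordinates. *)
Lemma root_walk_length P (D : set 'cV[R]_n) t u w :
  (forall g, D g -> root_direction g) -> walk P D t u w ->
  (forall i, u i 0 <= w i 0) ->
  (n <= #|[set i : 'I_n | (u i 0 == w i 0)%R]%SET| + t)%N.
Proof.
move=> rootD /(walk_components rootD) [F [cF sF]] uw.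
set E := [set i : 'I_n | (u i 0 == w i 0)%R]%SET.
have sub : F @: [set: option 'I_n]%SET \subset
    (F None |: ((fun i => F (Some i)) @: E))%SET.
  apply/fintype.subsetP => _ /imsetP [[i|] _ ->]; rewrite !inE ?eqxx //.
  have [//|ne] := eqVneq (F (Some i)) (F None); apply/imsetP; exists i; rewrite //.
  (* The weight is the indicator of the component of [i]. *)
  have := sF (fun z => (z == F (Some i))%:R); rewrite eq_sym (negPf ne) => /(_ erefl).
  move=> sum0; rewrite inE eq_sym -subr_eq0.
  have ge0 j : j \in 'I_n -> 0 <= (F (Some j) == F (Some i))%:R * (w - u) j 0.
    by move=> _; rewrite mulr_ge0 // !mxE subr_ge0.
  by have := psumr_eq0P ge0 sum0 (isT : i \in 'I_n); rewrite eqxx mul1r !mxE => ->.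
rewrite -ltnS; apply: leq_trans cF _; rewrite -addSn leq_add2r.
apply: (leq_trans (subset_leq_card sub)); rewrite cardsU1 -add1n.
by apply: leq_add; [exact: leq_b1|exact: leq_imset_card].
Qed.

End RootWalkLength.

(** * The parking-function polytope *)

Section ParkingPolytope.
Local Open Scope classical_set_scope.
Local Open Scope ring_scope.
Variables (R : realType) (n : nat) (b : 'I_n -> nat).
Hypothesis b_gt0 : forall i, (0 < b i)%N.

Definition bound_sum (i : 'I_n) : R := (partial_sum b i)%:R.

Lemma partial_sum_gt0 i : (0 < partial_sum b i)%N.
Proof.
rewrite /partial_sum (bigD1 i) //=.
exact: leq_trans (b_gt0 i) (leq_addr _ _).
Qed.

Lemma partial_sum_incr (i j : 'I_n) : (i < j)%N ->
  (partial_sum b i < partial_sum b j)%N.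
Proof.
move=> ij; rewrite /partial_sum [X in (_ < X)%N](bigD1 j) //=.
rewrite -add1n leq_add //.
rewrite big_mkcond [X in (_ <= X)%N]big_mkcond leq_sum // => k _.
case: ifP => // ki; rewrite (leq_trans ki (ltnW ij)) /=.
have -> // : k != j by apply: contraTneq ki => ->; rewrite -ltnNge.
Qed.

Lemma bound_sum_ge1 i : 1 <= bound_sum i.
Proof. by rewrite ler1n partial_sum_gt0. Qed.

Lemma bound_sum_incr (i j : 'I_n) : (i < j)%N -> bound_sum i + 1 <= bound_sum j.
Proof. by move=> /partial_sum_incr ij; rewrite natr1 ler_nat. Qed.

Lemma parking_function_greedy_polytope beta : parking_function b beta ->
  greedy_polytope bound_sum (\col_i (tnth beta i)%:R).
Proof.
case=> pos le.
have pe : perm_eq (sort_tuple leq beta) beta by rewrite perm_sort.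
have [s es] := tuple_permP pe.
have sortE i : tnth (sort_tuple leq beta) i = tnth beta (s i).
  have -> : sort_tuple leq beta = [tuple tnth beta (s i) | i < n] by apply: val_inj.
  by rewrite tnth_mktuple.
apply: (@greedy_polytope_dominated _ _ _ bound_sum_incr s) => i; rewrite mxE.
  by rewrite ler1n.
by rewrite ler_nat -sortE le.
Qed.

(** The values [v] are nondecreasing in the index, so they are the sorted form of [beta], and each
    is at most the partial sum. *)
Lemma greedy_point_parking s m : exists2 beta, parking_function b beta &
  greedy_point bound_sum s m = \col_i (tnth beta i)%:R.
Proof.
pose v (i : 'I_n) := if (i < m)%N then 1%N else partial_sum b i.
have v_mono (i j : 'I_n) : (i <= j)%N -> (v i <= v j)%N.
  rewrite /v => ij; case: ifP => im; first by case: ifP => // _; apply: partial_sum_gt0.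
  case: ifP => jm; first by rewrite (leq_ltn_trans ij jm) in im.
  move: ij; rewrite leq_eqVlt => /orP [/eqP /val_inj -> //|].
  by move/partial_sum_incr/ltnW.
pose beta := [tuple v ((s^-1)%g j) | j < n].
pose sorted_beta := [tuple v i | i < n].
have sortE : sort_tuple leq beta = sorted_beta.
  apply: val_inj => /=.
  have -> : sort leq beta = sort leq sorted_beta.
    apply/(perm_sortP leq_total leq_trans anti_leq).
    apply/tuple_permP; exists (s^-1)%g.
    by congr (val _); apply: eq_from_tnth => j; rewrite !tnth_mktuple.
  apply: sorted_sort; first exact: leq_trans.
  apply/(sortedP 0%N) => i; rewrite size_tuple => i1n.
  have iv (k : 'I_n) : nth 0%N sorted_beta k = v k by rewrite -tnth_nth tnth_mktuple.
  by have := v_mono (Ordinal (ltnW i1n)) (Ordinal i1n) (leqnSn i); rewrite -!iv.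
exists beta.
  split=> i; first by rewrite tnth_mktuple /v; case: ifP => // _; apply: partial_sum_gt0.
  by rewrite sortE tnth_mktuple /v; case: ifP => // _; apply: partial_sum_gt0.
by apply/colP => j; rewrite !mxE tnth_mktuple /v; case: ifP.
Qed.

(** Parking functions satisfy the inequalities; conversely the greedy points, which generate the
    polyhedron, are parking functions. *)
Lemma parking_polytopeE : parking_polytope R b = greedy_polytope bound_sum.
Proof.
apply/seteqP; split; last first.
  apply: (greedy_polytope_sub_convex bound_sum_ge1 bound_sum_incr).
    move=> x y l; rewrite !inE => Px Py C [cC sC].
    by have := cC x y l; rewrite !inE; apply; [apply: Px|apply: Py].
  move=> s m; apply: sub_gen_smallest.
  by have [beta pf e] := greedy_point_parking s m; exists beta.
apply: smallest_sub; first exact: polyhedron_convex.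
by move=> x [beta pf ->]; apply: parking_function_greedy_polytope.
Qed.

Variables (n_gt0 : (0 < n)%N) (delta : nat).
Hypotheses (delta_le : (delta <= n)%N)
  (bound_sum_1 : forall i : 'I_n, (i < delta)%N -> bound_sum i = 1)
  (bound_sum_gt1 : forall i : 'I_n, (delta <= i)%N -> 1 < bound_sum i)
  (bound_sum_0 : bound_sum (Ordinal n_gt0) = 1 \/ 2 <= bound_sum (Ordinal n_gt0)).

Let P := parking_polytope R b.

Lemma parking_root_circuit g : root_direction g -> circuit P g.
Proof.
rewrite /P parking_polytopeE.
exact: (root_direction_circuit bound_sum_ge1 bound_sum_incr bound_sum_0).
Qed.

Lemma parking_short_walk (D : set 'cV[R]_n) u w :
  (forall g, root_direction g -> D g) -> vertex P u -> vertex P w ->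
  exists2 t, walk P D t u w & (t <= n - delta)%N.
Proof.
rewrite /P parking_polytopeE => rootD.
exact: (short_walk bound_sum_ge1 bound_sum_incr rootD bound_sum_gt1 delta_le bound_sum_1).
Qed.

Let ones := greedy_point bound_sum 1%g n.
Let top := greedy_point bound_sum 1%g 0.

Lemma vertex_ones : vertex P ones.
Proof. by rewrite /P parking_polytopeE; apply: vertex_greedy_ones bound_sum_ge1 bound_sum_incr _. Qed.

Lemma vertex_top : vertex P top.
Proof. by rewrite /P parking_polytopeE; apply: vertex_greedy_top bound_sum_ge1 bound_sum_incr. Qed.

Lemma parking_circuit_diameter :
  exists2 k, circuit_diameter P k & (k <= n - delta)%N.
Proof.
apply: (walk_diameter_exists vertex_ones) => u w.
exact: parking_short_walk parking_root_circuit.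
Qed.

Lemma parking_root_circuit_diameter : root_circuit_diameter P (n - delta).
Proof.
apply: walk_diameter_attained vertex_ones vertex_top _.
  move=> u w; apply: parking_short_walk => g rg.
  by split=> //; apply: parking_root_circuit.
move=> t Wt.
have onesE i : ones i 0 = 1 by rewrite mxE ltn_ord.
have topE i : top i 0 = bound_sum i by rewrite mxE invg1 perm1.
rewrite leq_subLR; apply: leq_trans (root_walk_length _ Wt _) _.
- by move=> g [].
- by move=> i; rewrite onesE topE bound_sum_ge1.
(* The complement of [T] consists of the [delta] indices with bound 1, the only coordinates that may
   agree in [ones] and [top]. *)
pose T := [set j : 'I_n | (delta <= ((1 : 'S_n)^-1)%g j)%N]%SET.
have cT : #|~: T| = delta.
  by rewrite cardsCs finset.setCK card_ord card_tail_set // subKn.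
rewrite leq_add2r -[X in (_ <= X)%N]cT; apply: subset_leq_card.
apply/fintype.subsetP => i; rewrite !inE onesE topE invg1 perm1 => /eqP e.
by apply/negP => /bound_sum_gt1; rewrite -e ltxx.
Qed.

End ParkingPolytope.

Theorem theorem4p6 (R : realType) (n : nat) (n_gt0 : (0 < n)%N)
    (b : 'I_n -> nat) (b_gt0 : forall i, (0 < b i)%N)
    (not_point : ~ (n = 1%N /\ b (Ordinal n_gt0) = 1%N)) :
  (b (Ordinal n_gt0) = 1%N ->
     (exists2 k, circuit_diameter (parking_polytope R b) k & (k <= n - 1)%N) /\
     root_circuit_diameter (parking_polytope R b) (n - 1)) /\
  ((2 <= b (Ordinal n_gt0))%N ->
     (exists2 k, circuit_diameter (parking_polytope R b) k & (k <= n)%N) /\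
     root_circuit_diameter (parking_polytope R b) n).
Proof.
pose i0 := Ordinal n_gt0.
have b0 : partial_sum b i0 = b i0.
  rewrite /partial_sum (big_pred1 i0) // => j.
  by rewrite leqn0 /= -val_eqE.
have le0 (i : 'I_n) : (partial_sum b i0 <= partial_sum b i)%N.
  case: (posnP i) => [i_0|i_gt0].
    by have -> : i = i0 by apply: val_inj.
  by apply: ltnW; apply: partial_sum_incr.
split=> [b1|b2].
  (* Here [delta = 1]: only the first partial sum is 1. *)
  have B1 (i : 'I_n) : (i < 1)%N -> bound_sum R b i = 1%R.
    rewrite ltnS leqn0 => /eqP i_0; have -> : i = i0 by apply: val_inj.
    by rewrite /bound_sum b0 b1.
  have Bgt1 (i : 'I_n) : (1 <= i)%N -> (1 < bound_sum R b i)%R.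
    move=> i_gt0; rewrite ltr1n; apply: leq_ltn_trans (partial_sum_incr b_gt0 (i := i0) i_gt0).
    exact: partial_sum_gt0.
  have B0 : bound_sum R b i0 = 1%R \/ (2 <= bound_sum R b i0)%R by left; apply: B1.
  by split; [apply: (parking_circuit_diameter b_gt0 n_gt0 B1 Bgt1 B0)
            |apply: (parking_root_circuit_diameter b_gt0 n_gt0 B1 Bgt1 B0)].
(* Here [delta = 0]: already the first partial sum is at least 2. *)
have B1 (i : 'I_n) : (i < 0)%N -> bound_sum R b i = 1%R by [].
have Bgt1 (i : 'I_n) : (0 <= i)%N -> (1 < bound_sum R b i)%R.
  by move=> _; rewrite ltr1n; apply: leq_trans (le0 i); rewrite b0.
have B0 : bound_sum R b i0 = 1%R \/ (2 <= bound_sum R b i0)%R.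
  by right; rewrite ler_nat b0.
have := parking_circuit_diameter b_gt0 (leq0n n) B1 Bgt1 B0.
have := parking_root_circuit_diameter b_gt0 (leq0n n) B1 Bgt1 B0.
by rewrite subn0.
Qed.
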